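(* Let $A$ be a unital prime $C^*$-algebra with nonzero socle and let $a\in A$. The following conditions are equivalent: (1) $a\in A^{-1}$, i.e. $a$ is invertible in $A$; (2) for every $u\in F_1(A)$, there exist nonzero elements $x\in uA$ and $y\in Au$ such that $x\leq_\diamond a$ and $y\leq_\diamond a$.
   Context: All algebras are complex. For elements $a,b$ of a unital $C^*$-algebra $A$, the diamond relation is defined by: $a\leq_\diamond b$ if and only if $aA\subseteq bA$, $Aa\subseteq Ab$ and $aa^*a=ab^*a$. $F_1(A)$ denotes the set of rank-one elements of $A$, i.e. the nonzero elements $u\in A$ that belong to some minimal left (equivalently, right) ideal of $A$; equivalently, $u\neq 0$ and $uAu=\mathbb{C}u$. The socle $\mathrm{Soc}(A)$ is the sum of all minimal left ideals (equivalently, of all minimal right ideals) of $A$. *)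

(* Defs.v *)
From HB Require Import structures.
From mathcomp Require Import all_boot all_order all_algebra.
From mathcomp Require Import all_classical all_reals all_analysis.
From mathcomp Require Import complex.

Set Implicit Arguments.
Unset Strict Implicit.
Unset Printing Implicit Defensive.

Import Order.TTheory GRing.Theory Num.Theory.
Import numFieldNormedType.Exports.

Local Open Scope classical_set_scope.
Local Open Scope ring_scope.
Local Open Scope complex_scope.

(* Unital complex C*-algebras.  The norm is a field of its own, with values in
   R, because the normed structures of the library cannot be joined with its
   noncommutative unital rings.  In a [GRing.UnitAlgebra], [GRing.unit] is
   exactly the set of two-sided invertible elements. *)
HB.mixin Record isCStarAlgebra (R : realType) A of GRing.UnitAlgebra R[i] A := {
  cnorm : A -> R ;
  star : A -> A ;
  cnorm_ge0 : forall x : A, 0 <= cnorm x ;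
  cnorm_eq0 : forall x : A, cnorm x = 0 -> x = 0 ;
  cnormD : forall x y : A, cnorm (x + y) <= cnorm x + cnorm y ;
  cnormZ : forall (c : R[i]) (x : A), cnorm (c *: x) = Normc.normc c * cnorm x ;
  cnormM : forall x y : A, cnorm (x * y) <= cnorm x * cnorm y ;
  cnorm_complete : forall u : nat -> A,
    (forall e : R, 0 < e -> \forall m & n \near \oo, cnorm (u m - u n) < e) ->
    exists l : A, cnorm (u n - l) @[n --> \oo] --> (0 : R) ;
  starD : forall x y : A, star (x + y) = star x + star y ;
  starZ : forall (c : R[i]) (x : A), star (c *: x) = Num.conj c *: star x ;
  starM : forall x y : A, star (x * y) = star y * star x ;
  starK : forall x : A, star (star x) = x ;
  cnorm_starM : forall x : A, cnorm (star x * x) = cnorm x ^+ 2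
}.

#[short(type="cstarAlgType")]
HB.structure Definition CStarAlgebra (R : realType) :=
  { A of GRing.UnitAlgebra R[i] A & isCStarAlgebra R A }.

Section Ideals.
Variable A : nzRingType.
Implicit Types (I J L : set A) (a b u x : A).

(* As A is unital, when A is a complex algebra the one-sided ideals below are
   automatically complex subspaces. *)
Definition left_ideal L : Prop :=
  [/\ L 0, (forall x y, L x -> L y -> L (x + y))
    & forall a x, L x -> L (a * x)].

Definition two_sided_ideal I : Prop :=
  left_ideal I /\ forall a x, I x -> I (x * a).

Definition minimal_left_ideal L : Prop :=
  [/\ left_ideal L, L <> [set 0]
    & forall J, left_ideal J -> J `<=` L -> J = [set 0] \/ J = L].

Definition prime_ring : Prop :=
  forall I J, two_sided_ideal I -> two_sided_ideal J ->
    (forall x y, I x -> J y -> x * y = 0) -> I = [set 0] \/ J = [set 0].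

Definition rank_one : set A :=
  [set u | u <> 0 /\ exists2 L, minimal_left_ideal L & L u].

Definition socle : set A :=
  [set x | exists2 s : seq A,
     (forall v, v \in s -> exists2 L, minimal_left_ideal L & L v)
     & x = \sum_(v <- s) v].

Definition right_multiples a : set A := [set a * z | z in [set: A]].
Definition left_multiples a : set A := [set z * a | z in [set: A]].

End Ideals.
Arguments socle A : clear implicits.

Definition diamond_le (R : realType) (A : cstarAlgType R) (a b : A) : Prop :=
  [/\ right_multiples a `<=` right_multiples b,
      left_multiples a `<=` left_multiples b
    & a * star a * a = a * star b * a].

(* Main.v *)
(* If a is invertible and e, p are self-adjoint idempotents in Au and uA, then
   x = p a and y = a e work.  Such e and p are found algebraically, from
   h = u^* u = b h^2 with b given by minimality.

   Conversely, fix a rank-one projection p.  Each w in pA generates a minimal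
   left ideal, so (2) puts w in Aa and in Aa^*.  Hence pA is contained in Ak for
   k = a a^* and for k = a^* a, and a gliding hump shows that right
   multiplication by k is bounded below on pA, say by d.  If c is a "bump
   function" of k supported near 0, then z c = 0 for all z in pA, since right
   multiplication by k is small on pA c; primeness gives c = 0, and the vanishing
   of c makes k invertible.  The bump is built without functional calculus, from
   the Cayley transform of i k (2/d) and one square root, obtained by an
   iteration that converges in norm. *)
Require Import Defs.
From mathcomp Require Import all_boot all_order all_algebra.
From mathcomp Require Import all_classical all_reals all_analysis.
From mathcomp Require Import complex ring lra.

Set Implicit Arguments.
Unset Strict Implicit.
Unset Printing Implicit Defensive.

Import Order.TTheory GRing.Theory Num.Theory.
Import numFieldNormedType.Exports.
Local Open Scope classical_set_scope.
Local Open Scope ring_scope.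

(** * Norm, involution and limits *)

Section Norm.
Context {R : realType} {A : cstarAlgType R}.
Implicit Types (x y z : A).

Lemma cnormZr (r : R) x : 0 <= r -> cnorm (r%:C%C *: x) = r * cnorm x.
Proof.
move=> r0; rewrite cnormZ; congr (_ * _).
by rewrite /Normc.normc /= expr0n addr0 sqrtr_sqr ger0_norm.
Qed.

Lemma cnorm0 : cnorm (0 : A) = 0.
Proof. by rewrite -(scale0r (0 : A)) cnormZ Normc.normc0 mul0r. Qed.

Lemma cnormN x : cnorm (- x) = cnorm x.
Proof.
by rewrite -scaleN1r cnormZ /Normc.normc /= sqrrN oppr0 !expr2 mul0r mulr1
  addr0 sqrtr1 mul1r.
Qed.

Lemma cdistC x y : cnorm (x - y) = cnorm (y - x).
Proof. by rewrite -cnormN opprB. Qed.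

Lemma cnormB x y : cnorm (x - y) <= cnorm x + cnorm y.
Proof. by rewrite -(cnormN y) cnormD. Qed.

Lemma cnorm_gt0 x : x <> 0 -> 0 < cnorm x.
Proof.
move=> x0; rewrite lt_def cnorm_ge0 andbT.
by apply/eqP => /cnorm_eq0.
Qed.

Lemma star0 : star (0 : A) = 0.
Proof. by apply: (addrI (star 0)); rewrite -starD !addr0. Qed.

Lemma starN x : star (- x) = - star x.
Proof. by apply/eqP; rewrite -addr_eq0 -starD addNr star0. Qed.

Lemma starB x y : star (x - y) = star x - star y.
Proof. by rewrite starD starN. Qed.

Lemma star1 : star (1 : A) = 1.
Proof. by have := starM 1 (star (1 : A)); rewrite mul1r !starK mul1r. Qed.

Lemma starZr (r : R) x : star (r%:C%C *: x) = r%:C%C *: star x.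
Proof. by rewrite starZ -[Num.conj _]/(conjc _) conjc_real. Qed.

Lemma star_unit x : x \is a GRing.unit -> star x \is a GRing.unit.
Proof.
move=> ux; apply/unitrP; exists (star x^-1).
by rewrite -!starM mulVr// divrr// star1.
Qed.

Lemma starV x : x \is a GRing.unit -> star x^-1 = (star x)^-1.
Proof.
move=> ux; rewrite -[LHS](mulKr (star_unit ux)).
by rewrite -starM mulVr// star1 mulr1.
Qed.

Lemma cnorm1 : cnorm (1 : A) = 1.
Proof.
have n0 : cnorm (1 : A) != 0.
  by apply/eqP => /cnorm_eq0 /eqP; rewrite oner_eq0.
by apply: (mulfI n0); rewrite -expr2 -cnorm_starM star1 !mulr1.
Qed.

Lemma cnorm_star x : cnorm (star x) = cnorm x.
Proof.
suff le y : cnorm y <= cnorm (star y).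
  by apply/eqP; rewrite eq_le -{2}(starK x) !le.
have [->|/eqP/cnorm_gt0 y0] := eqVneq y 0; first by rewrite star0.
by rewrite -(ler_pM2r y0) -expr2 -cnorm_starM cnormM.
Qed.

Lemma star_mul_eq0 x : star x * x = 0 -> x = 0.
Proof.
move=> xx; apply: cnorm_eq0; apply/eqP.
by rewrite -sqrf_eq0 -cnorm_starM xx cnorm0.
Qed.

Lemma cnorm_isometry x : star x * x = 1 -> cnorm x = 1.
Proof.
move=> xx; apply/eqP; rewrite -sqrp_eq1 ?cnorm_ge0//.
by rewrite -cnorm_starM xx cnorm1.
Qed.

Lemma cnorm_cvg0_eq0 (f : nat -> R) x :
  (forall n, cnorm x <= f n) -> f n @[n --> \oo] --> (0 : R) -> x = 0.
Proof.
move=> xf f0; apply: cnorm_eq0; apply/eqP; rewrite eq_le cnorm_ge0 andbT.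
have := f0; move/cvg_lim => <-//.
by apply: limr_ge; [apply/cvg_ex; exists 0|near=> n; exact: xf].
Unshelve. all: by end_near. Qed.

(** Telescoping bounds [cnorm (u m - u n)] by [r m - r n] for [n <= m], and [r] converges, being
    nondecreasing and bounded, so [u] is Cauchy. The explicit error [M - r n] later controls the
    size of limits and of tails. *)
Lemma cnorm_majorized_cvg (u : nat -> A) (r : nat -> R) (M : R) :
  (forall n, cnorm (u n.+1 - u n) <= r n.+1 - r n) -> (forall n, r n <= M) ->
  exists l : A, (forall n, cnorm (l - u n) <= M - r n) /\
                cnorm (l - u n) @[n --> \oo] --> (0 : R).
Proof.
move=> ur rM.
have dist n k : cnorm (u (n + k)%N - u n) <= r (n + k)%N - r n.
  elim: k => [|k IHk]; first by rewrite addn0 !subrr cnorm0.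
  rewrite addnS -(subrKA (u (n + k)%N)).
  apply: (le_trans (cnormD _ _)).
  by apply: (le_trans (lerD (ur _) IHk)); rewrite subrKA.
have distle n m : (n <= m)%N -> cnorm (u m - u n) <= r m - r n.
  by move=> nm; rewrite -(subnKC nm).
have rnd : nondecreasing_seq r.
  apply/nondecreasing_seqP => n; rewrite -subr_ge0.
  exact: le_trans (cnorm_ge0 _) (ur n).
have rcvg : cvgn r.
  apply: nondecreasing_is_cvgn => //.
  by exists M => _ [n _ <-].
have [l ul] : exists l : A, cnorm (u n - l) @[n --> \oo] --> (0 : R).
  apply: cnorm_complete => e e0.
  have /cvgrPdist_lt/(_ _ e0) [N _ rN] := rcvg.
  exists ([set n | (N <= n)%N], [set n | (N <= n)%N]).
    by split; exists N.
  move=> [m n] /= [Nm Nn].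
  have key p q : (N <= p)%N -> (p <= q)%N -> cnorm (u q - u p) < e.
    move=> Np pq; apply: le_lt_trans (distle _ _ pq) _.
    have := rN p Np; rewrite /= ltr_norml => /andP[_].
    apply: le_lt_trans; rewrite lerD2r.
    exact: nondecreasing_cvgn_le.
  case: (leqP n m) => [nm|/ltnW mn]; first exact: key.
  by rewrite cdistC; exact: key.
exists l; split; last first.
  by under eq_fun do rewrite cdistC.
move=> n; rewrite -subr_le0.
have := ul; move/cvg_lim => <-//.
apply: limr_ge; first by apply/cvg_ex; exists 0.
near=> m.
have nm : (n <= m)%N by near: m; exists n.
rewrite lerBlDr.
have -> : l - u n = (l - u m) + (u m - u n) by rewrite subrKA.
apply: (le_trans (cnormD _ _)); rewrite cdistC lerD2l.
by apply: (le_trans (distle _ _ nm)); rewrite lerD2r.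
Unshelve. all: by end_near. Qed.

End Norm.

(** * Fixed-point iterations: Neumann series and square roots *)

Section Iteration.
Context {R : realType} {A : cstarAlgType R}.
Implicit Types (x y z : A).

(** Convergence is given, so [K] may exceed 1: the estimate only expresses continuity of [phi] at
    [l] along the sequence. *)
Lemma cnorm_cvg_fixpoint (phi : A -> A) (u : nat -> A) (l : A) (K : R) :
  (forall n, u n.+1 = phi (u n)) ->
  (forall n, cnorm (phi l - phi (u n)) <= K * cnorm (l - u n)) ->
  cnorm (l - u n) @[n --> \oo] --> (0 : R) -> l = phi l.
Proof.
move=> uS lip ul; apply/eqP; rewrite -subr_eq0; apply/eqP.
apply: (@cnorm_cvg0_eq0 _ _
  (fun n => cnorm (l - u n.+1) + K * cnorm (l - u n))).
  move=> n; have -> : l - phi l = (l - u n.+1) - (phi l - phi (u n)).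
    by rewrite uS opprB addrA subrK.
  by apply: (le_trans (cnormB _ _)); rewrite lerD2l.
rewrite -[0]addr0; apply: cvgD.
  by rewrite (cvg_shiftS (fun n => cnorm (l - u n))).
by rewrite -(mulr0 K); apply: cvgMr.
Qed.

Lemma cnorm_cvg_comm (u : nat -> A) (l b : A) :
  cnorm (l - u n) @[n --> \oo] --> (0 : R) ->
  (forall n, GRing.comm b (u n)) -> GRing.comm b l.
Proof.
move=> ul bu; apply/eqP; rewrite -subr_eq0; apply/eqP.
apply: (@cnorm_cvg0_eq0 _ _ (fun n => (cnorm b *+ 2) * cnorm (l - u n))).
  move=> n; have -> : b * l - l * b = b * (l - u n) - (l - u n) * b.
    by rewrite mulrBr mulrBl bu opprB addrA subrK.
  rewrite mulrnAl mulr2n; apply: (le_trans (cnormB _ _)).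
  by apply: lerD; [|rewrite [leRHS]mulrC]; exact: cnormM.
by rewrite -(mulr0 (cnorm b *+ 2)); apply: cvgMr.
Qed.

(** The geometric partial sums are iterates of [y] to [1 + x * y], majorised by the real iteration
    with [rho], whose fixed point is [(1 - rho)^-1]. The limit commutes with [x], hence is a
    two-sided inverse. *)
Lemma neumann_unit x : cnorm x < 1 -> 1 - x \is a GRing.unit.
Proof.
set rho := cnorm x => rho1; have rho0 : 0 <= rho := cnorm_ge0 x.
pose u := fix u n : A := if n is m.+1 then 1 + x * u m else 0.
pose r := fix r n : R := if n is m.+1 then 1 + rho * r m else 0.
have ur n : cnorm (u n.+1 - u n) <= r n.+1 - r n.
  elim: n => [|n IHn]; first by rewrite /= !mulr0 !addr0 !subr0 cnorm1.
  rewrite [u n.+2]/= [X in _ - X]/= [r n.+2]/= [X in _ <= _ - X]/=.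
  rewrite [1 + x * _]addrC addrKA -mulrBr [1 + rho * _]addrC addrKA -mulrBr.
  by apply: (le_trans (cnormM _ _)); apply: ler_wpM2l.
have rM n : r n <= (1 - rho)^-1.
  have d0 : 0 < 1 - rho by rewrite subr_gt0.
  elim: n => [|n IHn] /=; first by rewrite invr_ge0 ltW.
  have -> : (1 - rho)^-1 = 1 + rho * (1 - rho)^-1.
    by field; rewrite lt0r_neq0.
  by rewrite lerD2l ler_wpM2l.
have [l [_ ul]] := cnorm_majorized_cvg ur rM.
have l1 : l = 1 + x * l.
  apply: (@cnorm_cvg_fixpoint (fun y => 1 + x * y) _ _ rho _ _ ul) => // n.
  by rewrite [1 + _]addrC addrKA -mulrBr cnormM.
have xl : GRing.comm x l.
  apply: cnorm_cvg_comm ul _; elim=> [|n IHn] /=; first exact: commr0.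
  by apply: commrD; [exact: commr1|apply: commrM].
by apply/unitrP; exists l; rewrite mulrBr mulrBl mulr1 mul1r -xl {1 3}l1 addrK.
Qed.

(* The iteration X <- (y + X^2)/2 converges to 1 - sqrt (1 - y), majorised by
   the same real iteration at y = 1. *)
Lemma sqrt_one_minus y : cnorm y <= 1 ->
  exists s : A, [/\ s * s = 1 - y, cnorm (1 - s) <= 1
                  & forall b, GRing.comm b y -> GRing.comm b s].
Proof.
move=> y1.
pose phi z : A := (2^-1)%:C%C *: (y + z * z).
pose u := fix u n : A := if n is m.+1 then phi (u m) else 0.
pose r := fix r n : R := if n is m.+1 then 2^-1 * (1 + r m * r m) else 0.
have h0 : 0 <= 2^-1 :> R by rewrite invr_ge0.
have uS n : u n.+1 = phi (u n) by [].
have rS n : r n.+1 = 2^-1 * (1 + r n * r n) by [].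
have r01 n : 0 <= r n <= 1.
  by elim: n => [|n /andP[IH0 IH1]] /=; [rewrite lexx ler01|apply/andP; nra].
have un n : cnorm (u n) <= r n.
  elim: n => [|n IHn] /=; first by rewrite cnorm0.
  rewrite cnormZr//; apply: ler_wpM2l => //.
  apply: (le_trans (cnormD _ _)); apply: lerD => //.
  by apply: (le_trans (cnormM _ _)); apply: ler_pM; rewrite ?cnorm_ge0.
have sqrB a b : a * a - b * b = a * (a - b) + (a - b) * b :> A.
  by rewrite mulrBr mulrBl addrA subrK.
have phiB a b : phi a - phi b = (2^-1)%:C%C *: (a * (a - b) + (a - b) * b).
  by rewrite /phi -scalerBr [y + _]addrC addrKA sqrB.
have ur n : cnorm (u n.+1 - u n) <= r n.+1 - r n.
  elim: n => [|n IHn].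
    rewrite /= /phi !mulr0 !addr0 !subr0 cnormZr//; exact: ler_wpM2l.
  rewrite (uS n.+1) [X in _ - X](uS n) phiB cnormZr//.
  have -> : r n.+2 - r n.+1 =
      2^-1 * (r n.+1 * (r n.+1 - r n) + (r n.+1 - r n) * r n).
    by rewrite (rS n.+1) [X in _ - X = _](rS n); ring.
  apply: ler_wpM2l => //; apply: (le_trans (cnormD _ _)).
  by apply: lerD; apply: (le_trans (cnormM _ _));
     apply: ler_pM; rewrite ?cnorm_ge0 ?un.
have rM n : r n <= 1 by have /andP[] := r01 n.
have [l [lu ul]] := cnorm_majorized_cvg ur rM.
(* The Lipschitz constant comes from [phiB] and [cnorm (u n) <= 1]. *)
have l1 : l = phi l.
  apply: (@cnorm_cvg_fixpoint phi _ _ (2^-1 * (cnorm l + 1)) _ _ ul) => // n.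
  rewrite phiB cnormZr// -mulrA; apply: ler_wpM2l => //.
  rewrite [leRHS]mulrDl mul1r; apply: (le_trans (cnormD _ _)).
  apply: lerD.
    exact: cnormM.
  apply: (le_trans (cnormM _ _)); rewrite -[leRHS]mulr1.
  by apply: ler_pM; rewrite ?cnorm_ge0// (le_trans (un n)).
have l2 : l + l = y + l * l.
  rewrite {1 2}l1 /phi -scalerDl -rmorphD /=.
  by rewrite (_ : 2^-1 + 2^-1 = 1 :> R) ?scale1r//; lra.
exists (1 - l); split.
- have -> : y = l + l - l * l by rewrite l2 addrK.
  by rewrite mulrBl mul1r mulrBr mulr1 -addrA -opprD addrA.
- by rewrite subKr; have := lu 0%N; rewrite /= !subr0.
- move=> b yb; apply: commrB; first exact: commr1.
  apply: cnorm_cvg_comm ul _; elim=> [|n IHn] /=; first exact: commr0.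
  rewrite /phi /GRing.comm -scalerAr -scalerAl; congr (_ *: _).
  by apply: commrD => //; apply: commrM.
Qed.

End Iteration.

(** * Cutoffs of skew-adjoint elements *)

Section SkewAdjoint.
Context {R : realType} {A : cstarAlgType R}.
Implicit Types (x y z d : A).

Lemma cnorm_double x : cnorm (x + x) = 2 * cnorm x.
Proof.
rewrite -cnormZr// (_ : x + x = 2%:C%C *: x)//.
by rewrite -mulr2n -scaler_nat -(rmorph_nat (real_complex R)).
Qed.

Lemma cayley_norm d : d \is a GRing.unit -> GRing.comm (star d) d ->
  cnorm (star d * d^-1) = 1.
Proof.
move=> ud cd; apply: cnorm_isometry.
rewrite starM starK starV// -mulrA (mulrA d) -cd mulrA mulrA mulVr ?mul1r//.
  by rewrite divrr.
exact: star_unit.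
Qed.

(** For large real [T], [d = T + x] is a unit by the Neumann series. As [star d + d = 2 T],
    [cayley_norm] gives [cnorm d^-1 <= T^-1], and then [1 + x = d * (1 - (T - 1) d^-1)] is within
    reach of the Neumann series again. *)
Lemma skew_unit x : star x = - x -> 1 + x \is a GRing.unit.
Proof.
move=> sx; set T := cnorm x + 2.
have T0 : 0 < T by rewrite ltr_pwDr// cnorm_ge0.
have Tn0 : T%:C%C != 0 by rewrite fmorph_eq0 gt_eqF.
pose d : A := T%:C%C *: 1 + x.
have ud : d \is a GRing.unit.
  have -> : d = T%:C%C *: (1 - (T^-1)%:C%C *: - x).
    by rewrite scalerBr !scalerN scalerA -rmorphM divff ?gt_eqF//
      scale1r opprK.
  rewrite GRing.scaler_unit ?unitfE//; apply: neumann_unit.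
  rewrite cnormZr ?invr_ge0 ?ltW// cnormN mulrC ltr_pdivrMr// mul1r.
  by rewrite ltrDl.
have sd : star d = T%:C%C *: 1 - x by rewrite starD starZr star1 sx.
have cd : GRing.comm (star d) d.
  rewrite sd /d; apply: commrD; last apply: commr_sym; last first.
    apply: commrB; last exact: commr_refl.
    by rewrite /GRing.comm -scalerAr -scalerAl mulr1 mul1r.
  by rewrite /GRing.comm -scalerAr -scalerAl mulr1 mul1r.
have dV : cnorm d^-1 <= T^-1.
  have := cnormD (star d * d^-1) 1.
  rewrite cayley_norm// cnorm1 -{1}(divrr ud) -mulrDl sd addrC {1}/d.
  rewrite addrACA subrr addr0 mulrDl cnorm_double -scalerAl mul1r.
  rewrite (cnormZr _ (ltW T0)) => dT.
  have {}dT : T * cnorm d^-1 <= 1 by lra.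
  by rewrite -[leRHS]mul1r ler_pdivlMr// mulrC.
have -> : 1 + x = d * (1 - (T - 1)%:C%C *: d^-1).
  rewrite mulrBr mulr1 -scalerAr divrr// /d rmorphB rmorph1 scalerBl scale1r.
  by rewrite opprB [in RHS](addrC _ x) [RHS]addrA [RHS]addrAC addrK addrC.
rewrite unitrMl//; apply: neumann_unit.
have T1 : 0 <= T - 1 by rewrite subr_ge0 /T; have := cnorm_ge0 x; lra.
rewrite cnormZr//; apply: le_lt_trans (ler_wpM2l T1 dV) _.
by rewrite ltr_pdivrMr// mul1r ltrBlDr ltrDl.
Qed.

(* With x = i k, k self-adjoint, y and s are the functions
   (1 - k^2)/(1 + k^2) and |y| of k.  So c = 2 y^+ is supported on |k| < 1,
   where the cutoff g equals 1, while g = 2/(1 + k^2) on |k| >= 1. *)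
Lemma skew_cutoff x : star x = - x ->
  exists c g : A, [/\ c * g = c, cnorm (g * x) <= 3 / 2
                    & c = 0 -> x \is a GRing.unit].
Proof.
move=> sx; have ud := skew_unit sx.
have sd : star (1 + x) = 1 - x by rewrite starD star1 sx.
have ud' : 1 - x \is a GRing.unit by rewrite -sd star_unit.
have cd : GRing.comm (1 - x) (1 + x).
  apply: commrD; first exact: commr1.
  apply: commr_sym; apply: commrB; [exact: commr1|exact: commr_refl].
have nu := cayley_norm ud; have nu' := cayley_norm ud'.
have sd' : star (1 - x) = 1 + x by rewrite -sd starK.
rewrite sd in nu; rewrite sd' in nu'.
have {}nu := nu cd; have {}nu' := nu' (commr_sym cd).
set v := (1 + x)^-1 in nu; set v' := (1 - x)^-1 in nu'.
have vx : v * x = 1 - v by rewrite -(mulVr ud) mulrDr mulr1 addrC addKr.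
have xv : x * v = 1 - v by rewrite -(divrr ud) mulrDl mul1r addrC addKr.
have v'x : v' * x = v' - 1.
  by rewrite -(mulVr ud') mulrBr mulr1 opprB addrC subrK.
have xv' : x * v' = v' - 1.
  by rewrite -(divrr ud') mulrBl mul1r opprB addrC subrK.
(* Evaluate [v * x * v'] with both bracketings. *)
have vv' : v * v' + v * v' = v + v'.
  have := mulrA v x v'; rewrite vx xv' mulrBr mulrBl mulr1 mul1r => /eqP.
  by rewrite subr_eq addrAC eq_sym subr_eq => /eqP <-; rewrite addrC.
have cvv' : GRing.comm v v' := commrV (commr_sym (commrV cd)).
(* With [x = i k], these are [2/(1 + k^2)], [(1 - k^2)/(1 + k^2)] and [-2 i k/(1 + k^2)]. Both [y]
   and [F] have norm at most 1, as half the sum and half the difference of the Cayley transforms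
   [(1 - x) * v] and [(1 + x) * v']. *)
pose p := v + v'; pose y := p - 1; pose F := v - v'.
have ny : cnorm y <= 1.
  have := cnormD ((1 - x) * v) ((1 + x) * v'); rewrite nu nu'.
  rewrite mulrBl mulrDl !mul1r xv xv' opprB (addrA v v) (addrA v' v').
  rewrite addrACA (addrACA v v) -/p addrACA cnorm_double.
  by rewrite -/y; lra.
have nF : cnorm F <= 1.
  have := cnormB ((1 - x) * v) ((1 + x) * v'); rewrite nu nu'.
  rewrite mulrBl mulrDl !mul1r xv xv' opprB (addrA v v) (addrA v' v').
  rewrite opprD addrACA subrr addr0 opprD addrACA cnorm_double.
  by rewrite -/F; lra.
have ppE : p * p = v * v + v' * v' + p.
  rewrite mulrDl !mulrDr -cvv' /p -vv'.
  by rewrite [v * v' + v' * v']addrC addrACA.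
have FFE : F * F = v * v + v' * v' - p.
  rewrite mulrBl !mulrBr -cvv' /p -vv' opprB opprD.
  by rewrite addrACA.
have yyE : y * y = 1 + F * F.
  rewrite mulrBl mul1r mulrBr mulr1 ppE addrK FFE opprB addrA.
  by rewrite addrAC [RHS]addrC.
have y1x : (1 + y) * x = - F.
  by rewrite addrC subrK mulrDl vx v'x opprB addrC addrA subrK.
have Fx : F * x = 1 - y.
  by rewrite mulrBl vx v'x /y /p -addrA -opprD addrA.
have xF : x * F = 1 - y.
  by rewrite mulrBr xv xv' -Fx mulrBl vx v'x.
have yF : GRing.comm y F.
  apply: commr_sym; apply: commrB; last exact: commr1.
  by apply: commrD; apply: commr_sym; apply: commrB; 
    (exact: commr_refl || exact: cvv' || exact: commr_sym).
have nFF : cnorm (- (F * F)) <= 1.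
  rewrite cnormN; apply: (le_trans (cnormM _ _)).
  by apply: mulr_ile1; rewrite ?cnorm_ge0.
(* Since [1 + F * F = y * y], the root [s] plays the role of [|y|]. *)
have [s [ssE ns cs]] := sqrt_one_minus nFF.
rewrite opprK in ssE.
have ys : GRing.comm y s by apply: cs; apply: commrN; apply: commrM.
pose h := (2^-1 : R)%:C%C.
have hh z : h *: z + h *: z = z.
  rewrite -scalerDl -rmorphD (_ : 2^-1 + 2^-1 = 1 :> R) ?scale1r//; lra.
have h0 : 0 <= 2^-1 :> R by rewrite invr_ge0.
have us : 1 + s \is a GRing.unit.
  have -> : 1 + s = (2 : R)%:C%C *: (1 - h *: (1 - s)).
    rewrite scalerBr scalerA -rmorphM divff ?pnatr_eq0// scale1r.
    rewrite rmorph_nat scaler_nat mulr2n opprB [s - 1]addrC.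
    by rewrite addrA addrK.
  rewrite GRing.scaler_unit ?unitfE ?fmorph_eq0 ?pnatr_eq0//.
  by apply: neumann_unit; rewrite cnormZr//; lra.
(* Write [w] for [(1 + s)^-1]. From [2 w = 1 + (1 - s) w] and [cnorm (1 - s) <= 1] follows
   [2 cnorm w <= 1 + cnorm w]. *)
have nw : cnorm (1 + s)^-1 <= 1.
  have := cnormD 1 ((1 - s) / (1 + s)).
  have -> : 1 + (1 - s) / (1 + s) = (1 + s)^-1 + (1 + s)^-1.
    by rewrite -{1}(divrr us) -mulrDl addrACA subrr addr0 mulrDl mul1r.
  rewrite cnorm_double cnorm1 => H.
  have := cnormM (1 - s) (1 + s)^-1.
  have := ler_wpM2r (cnorm_ge0 (1 + s)^-1) ns.
  by lra.
(* Here [1 - s * s = - (F * F)] absorbs the factor [x] through [F * x = 1 - y], leaving a bound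
   independent of [cnorm x]. *)
have s1x : (1 - s) * x = - ((1 + s)^-1 * (F * (1 - y))).
  have -> : (1 - s) * x = (1 + s)^-1 * ((1 + s) * (1 - s) * x).
    by rewrite -[in RHS]mulrA mulKr.
  rewrite mulrDl mul1r mulrBr mulr1 addrA subrK ssE opprD addNKr.
  by rewrite mulNr mulrN -mulrA Fx.
(* That is, [c = 2 y^+] and [g = 1 - y^-]; then [c * g = c] because [(s + y) * (s - y) = 0]. In the
   norm of [g * x], the terms [(1 + y) * x] and [(1 - s) * x] contribute at most 1 and 2 before
   halving. *)
exists (s + y), (1 - h *: (s - y)); split.
- rewrite mulrBr mulr1 -scalerAr mulrDl (mulrBr s s) (mulrBr y s) ssE -yyE ys.
  by rewrite subrKA subrr scaler0 subr0.
- have -> : (1 - h *: (s - y)) * x = h *: ((1 + y) * x + (1 - s) * x).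
    rewrite -mulrDl scalerAl -[in LHS](hh 1) -scalerDr -scalerBr.
    by rewrite opprB addrACA.
  rewrite cnormZr// y1x s1x.
  have H : cnorm (- F - (1 + s)^-1 * (F * (1 - y))) <= 3.
    apply: (le_trans (cnormB _ _)); rewrite cnormN.
    have ny2 : cnorm (1 - y) <= 2.
      by apply: (le_trans (cnormB _ _)); rewrite cnorm1; lra.
    have nFy : cnorm (F * (1 - y)) <= 2.
      apply: (le_trans (cnormM _ _)); rewrite -[leRHS]mul1r.
      by apply: ler_pM; rewrite ?cnorm_ge0.
    have nwFy : cnorm ((1 + s)^-1 * (F * (1 - y))) <= 2.
      apply: (le_trans (cnormM _ _)); rewrite -[leRHS]mul1r.
      by apply: ler_pM; rewrite ?cnorm_ge0.
    by lra.
  by lra.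
(* If [y = - s], then [F * x = 1 - y = 1 + s] is a unit with commuting factors. *)
- move=> /eqP; rewrite addrC addr_eq0 => /eqP yNs.
  have : F * x \is a GRing.unit by rewrite Fx yNs opprK.
  have cFx : GRing.comm F x by rewrite /GRing.comm Fx xF.
  by rewrite (unitrM_comm cFx) => /andP[].
Qed.

End SkewAdjoint.

(** * Lower bounds for right multiplication and invertibility *)

Section BoundedBelow.
Context {R : realType} {A : cstarAlgType R}.
Implicit Types (b c p v w z : A).

(* A gliding hump: if unit vectors [z n] satisfy [z n * b -> 0] fast, a suitable
   signed series [w] of the [z n] keeps [w * star (z n)] too large for [w] to be
   of the form [v * star b]. *)
Lemma bounded_below p b :
  (forall w, p * w = w -> exists v, w = v * star b) ->
  exists2 d : R, 0 < d & forall z, p * z = z -> d * cnorm z <= cnorm (z * b).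
Proof.
move=> pb; apply: contrapT => nd.
(* With ratio 1/3, the terms after the [n]-th sum to [beta n / 2], so later humps destroy at most
   half of the size [beta n] reached at stage [n]. *)
pose beta n : R := 3^-1 ^+ n.
have beta0 n : 0 < beta n by rewrite exprn_gt0 ?invr_gt0.
have betaS n : beta n.+1 = beta n / 3 by rewrite /beta exprSr.
have /choice [z zP] : forall n : nat, exists z,
    [/\ p * z = z, cnorm z = 1 & cnorm (z * b) * n.+1%:R <= beta n].
  move=> n; apply: contrapT => nz; apply: nd; exists (beta n / n.+1%:R).
    by rewrite divr_gt0 ?ltr0n.
  move=> z pz; rewrite leNgt; apply/negP => zb; apply: nz.
  have z0 : 0 < cnorm z.
    apply: cnorm_gt0 => z0; move: zb.
    by rewrite z0 mul0r cnorm0 mulr0 ltxx.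
  exists ((cnorm z)^-1%:C%C *: z); split.
  - by rewrite -scalerAr pz.
  - by rewrite cnormZr ?invr_ge0 ?ltW// mulVf ?gt_eqF.
  - rewrite -scalerAl cnormZr ?invr_ge0 ?(ltW z0)//.
    rewrite -ler_pdivlMr ?ltr0n// mulrC ler_pdivrMr//; exact: ltW.
pose hump n w := w + (beta n)%:C%C *: z n.
pose w := fix w n : A := if n is m.+1 then
    if beta m <= cnorm (hump m (w m) * star (z m)) then hump m (w m)
    else w m - (beta m)%:C%C *: z m
  else 0.
have nt n : cnorm ((beta n)%:C%C *: z n) = beta n.
  by have [_ z1 _] := zP n; rewrite cnormZr ?(ltW (beta0 n))// z1 mulr1.
(* The sum of [beta m] over [m < n], with limit [3 / 2]. *)
pose r n : R := 3 / 2 * (1 - beta n).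
have wr n : cnorm (w n.+1 - w n) <= r n.+1 - r n.
  have -> : r n.+1 - r n = beta n by rewrite /r betaS; field.
  rewrite /=; case: ifP => _; first by rewrite addrC addKr nt.
  by rewrite addrC addKr cnormN nt.
have rM n : r n <= 3 / 2 by rewrite /r; have := beta0 n; lra.
(* The two sign choices, multiplied by [star (z n)], differ by [2 beta n] times [z n * star (z n)],
   which has norm 1. Hence at least one of them has norm at least [beta n]. *)
have wz n : beta n <= cnorm (w n.+1 * star (z n)).
  rewrite /=; case: ifPn => //; rewrite -ltNge => lt_beta.
  have := cnormB (hump n (w n) * star (z n))
    ((w n - (beta n)%:C%C *: z n) * star (z n)).
  rewrite -mulrBl {1}/hump opprB addrC addrA.
  have -> : (beta n)%:C%C *: z n - w n + w n + (beta n)%:C%C *: z n =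
     (beta n)%:C%C *: z n + (beta n)%:C%C *: z n by rewrite subrK.
  rewrite mulrDl cnorm_double -scalerAl cnormZr ?(ltW (beta0 n))//.
  rewrite -{1}(starK (z n)) cnorm_starM cnorm_star.
  by have [_ -> _] := zP n; rewrite expr1n mulr1; lra.
have pw n : p * w n = w n.
  have pt m : p * ((beta m)%:C%C *: z m) = (beta m)%:C%C *: z m.
    by have [pz _ _] := zP m; rewrite -scalerAr pz.
  elim: n => [|n IHn] /=; first by rewrite mulr0.
  by case: ifP => _; rewrite /hump ?mulrDr ?mulrN IHn pt.
have [l [lw wl]] := cnorm_majorized_cvg wr rM.
have pl : p * l = l.
  apply/eqP; rewrite -subr_eq0; apply/eqP.
  apply: (@cnorm_cvg0_eq0 _ _ (fun n => (cnorm p + 1) * cnorm (l - w n))).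
    move=> n; have -> : p * l - l = p * (l - w n) - (l - w n).
      by rewrite mulrBr pw opprB addrA subrK.
    rewrite mulrDl mul1r; apply: (le_trans (cnormB _ _)).
    by rewrite lerD2r cnormM.
  by rewrite -(mulr0 (cnorm p + 1)); apply: cvgMr.
have [v lv] := pb l pl.
(* [l * star (z n) = v * star (z n * b)] has norm at most [cnorm v * beta n / n.+1], yet at least
   [beta n / 2]; this fails for large [n]. *)
have big n : n.+1%:R <= 2 * cnorm v.
  have [_ z1 zb] := zP n.
  have lz : cnorm (l * star (z n)) * n.+1%:R <= cnorm v * beta n.
    rewrite lv -mulrA -starM -(cnorm_star (z n * b)) in zb *.
    apply: (le_trans (ler_wpM2r _ (cnormM _ _))) => //.
    by rewrite -mulrA ler_wpM2l ?cnorm_ge0.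
  have wlz : cnorm (w n.+1 * star (z n)) <=
      cnorm (l * star (z n)) + beta n / 2.
    have -> : w n.+1 * star (z n) =
        l * star (z n) - (l - w n.+1) * star (z n).
      by rewrite -mulrBl subKr.
    apply: (le_trans (cnormB _ _)); rewrite lerD2l.
    apply: (le_trans (cnormM _ _)); rewrite cnorm_star z1 mulr1.
    by apply: (le_trans (lw _)); rewrite /r betaS; lra.
  have := wz n => wzn.
  have n0 : 0 < n.+1%:R :> R by rewrite ltr0n.
  have hz : beta n / 2 <= cnorm (l * star (z n)) by lra.
  have := ler_wpM2r (ltW n0) hz => hzn.
  rewrite -(ler_pM2r (beta0 n)); lra.
have := @archi_boundP _ (2 * cnorm v) (mulr_ge0 (ler0n _ 2) (cnorm_ge0 v)).
have := big (Num.bound (2 * cnorm v)).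
by rewrite -natr1; lra.
Qed.

(** Apply [skew_cutoff] to [x = (2 i / d) k]. On [w = z * c] the lower bound gives
    [cnorm (w * x) >= 2 * cnorm w], while [w * x = w * (g * x)] has norm at most [3 / 2 * cnorm w];
    so [w = 0]. *)
Lemma selfadjoint_unit k p (d : R) : star k = k -> 0 < d ->
  (forall z, p * z = z -> d * cnorm z <= cnorm (z * k)) ->
  (forall c, (forall z, p * z = z -> z * c = 0) -> c = 0) ->
  k \is a GRing.unit.
Proof.
move=> sk d0 kd faithful.
pose e : R[i] := Complex 0 (2 / d).
have ne : Normc.normc e = 2 / d.
  by rewrite /Normc.normc /= expr0n add0r sqrtr_sqr ger0_norm ?divr_ge0 ?ltW.
have e0 : e != 0 by rewrite eq_complex /= eqxx /= mulf_neq0 ?invr_eq0 ?gt_eqF.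
have se : star (e *: k) = - (e *: k).
  rewrite starZ sk -scaleNr; congr (_ *: _).
  by apply/eqP; rewrite eq_complex /= oppr0 !eqxx.
have [c [g [cg gx unitx]]] := skew_cutoff se.
rewrite -(GRing.scaler_unit (k := e)) ?unitfE//; apply: unitx.
apply: faithful => z pz; set w := z * c.
have pw : p * w = w by rewrite mulrA pz.
have wg : w * g = w by rewrite -mulrA cg.
have : cnorm (w * (e *: k)) <= cnorm w * (3 / 2).
  rewrite -{1}wg -mulrA; apply: (le_trans (cnormM _ _)).
  by rewrite ler_wpM2l ?cnorm_ge0.
rewrite -scalerAr cnormZ ne mulrAC ler_pdivrMr// => wk.
have := kd w pw => kw.
apply: cnorm_eq0; apply/eqP; rewrite eq_le cnorm_ge0 andbT.
have : 2 * (d * cnorm w) <= cnorm w * (3 / 2) * d by lra.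
by rewrite -(pmulr_rle0 _ d0); lra.
Qed.

End BoundedBelow.

(** * Minimal ideals and projections *)

Section MinimalIdeals.
Context {A : nzRingType}.
Implicit Types (a c e w x : A) (L J : set A).

Lemma mem_left_multiples x : left_multiples x x.
Proof. by exists 1; rewrite ?mul1r. Qed.

Lemma left_ideal_left_multiples x : left_ideal (left_multiples x).
Proof.
split; first by exists 0; rewrite ?mul0r.
- by move=> _ _ [z _ <-] [t _ <-]; exists (z + t); rewrite ?mulrDl.
- by move=> a _ [z _ <-]; exists (a * z); rewrite ?mulrA.
Qed.

Lemma minimal_left_ideal_gen L x : minimal_left_ideal L -> L x -> x <> 0 ->
  left_multiples x = L.
Proof.
move=> [[L0 LD LM] _ minL] Lx x0.
have sub : left_multiples x `<=` L by move=> _ [z _ <-]; exact: LM.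
have [Z|//] := minL _ (left_ideal_left_multiples x) sub.
by have := mem_left_multiples x; rewrite Z.
Qed.

(** A left ideal inside [A e w] pulls back under right multiplication by [w] to a left ideal inside
    [A e], which is zero or everything. *)
Lemma minimal_left_ideal_mulr e w : minimal_left_ideal (left_multiples e) ->
  e * w <> 0 -> minimal_left_ideal (left_multiples (e * w)).
Proof.
move=> [_ _ minAe] ew0; split; first exact: left_ideal_left_multiples.
  by move=> Z; have := mem_left_multiples (e * w); rewrite Z.
move=> J [J0 JD JM] Jsub.
pose I := [set x | left_multiples e x /\ J (x * w)].
have [Ae0 AeD AeM] := left_ideal_left_multiples e.
have idI : left_ideal I.
  split; first by split; rewrite ?mul0r.
  - by move=> x y [? ?] [? ?]; split; [exact: AeD|rewrite mulrDl; exact: JD].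
  - by move=> a x [? ?]; split; [exact: AeM|rewrite -mulrA; exact: JM].
have [I0|IAe] := minAe I idI (fun x Ix => proj1 Ix).
- left; apply/seteqP; split=> [j Jj|_ -> //].
  have [z _ zj] := Jsub _ Jj.
  have : I (z * e) by split; [exists z|rewrite -mulrA zj].
  by rewrite I0 /= => ze; rewrite -zj mulrA ze mul0r.
- right; apply/seteqP; split=> // _ [z _ <-]; apply: JM.
  by have := mem_left_multiples e; rewrite -IAe => -[].
Qed.

(** The elements [x] with [x A c = 0] form a two-sided ideal [I] containing [p]; its right
    annihilator [J] is two-sided and contains [c]. Since [I J = 0] and [I] is nonzero, [J]
    vanishes. *)
Lemma prime_ring_annihilator p c : prime_ring A -> p <> 0 ->
  (forall z, p * z * c = 0) -> c = 0.
Proof.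
move=> prA p0 pc.
pose I := [set x : A | forall z, x * z * c = 0].
pose J := [set y : A | forall x, I x -> x * y = 0].
have idI : two_sided_ideal I.
  split; first split.
  - by move=> z; rewrite !mul0r.
  - by move=> x y Ix Iy z; rewrite !mulrDl Ix Iy addr0.
  - by move=> a x Ix z; rewrite -!mulrA mulrA [a * x * _]mulrA -!mulrA
      (mulrA x) Ix mulr0.
  - by move=> a x Ix z; rewrite -(mulrA x) Ix.
have idJ : two_sided_ideal J.
  split; first split.
  - by move=> x _; rewrite mulr0.
  - by move=> x y Jx Jy t It; rewrite mulrDr Jx// Jy// addr0.
  - by move=> a y Jy x Ix; rewrite mulrA Jy//; exact: (proj2 idI).
  - by move=> a y Jy x Ix; rewrite mulrA Jy// mul0r.
have [I0|J0] := prA _ _ idI idJ (fun x y Ix Jy => Jy x Ix).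
- by have : I p := pc; rewrite I0.
- have : J c by move=> x Ix; rewrite -(mulr1 x) Ix.
  by rewrite J0.
Qed.

Lemma exists_minimal_left_ideal : socle A <> [set 0] ->
  exists2 L, minimal_left_ideal L & exists2 v : A, L v & v <> 0.
Proof.
move=> soc; apply: contrapT => none; apply: soc; apply/seteqP; split.
  move=> _ [s sP ->] /=; rewrite big_seq big1// => v /sP[L minL Lv].
  by apply: contrapT => v0; apply: none; exists L => //; exists v.
by move=> _ ->; exists [::] => //; rewrite big_nil.
Qed.

End MinimalIdeals.

Section Projections.
Context {R : realType} {A : cstarAlgType R}.
Implicit Types (a e p u w : A).

(* For h = u^* u, minimality gives h = b h^2; then b h = h b^* is a self-adjoint
   idempotent, and b h b^* inverts h on it. *)
Lemma minimal_left_ideal_projections (L : set A) u :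
  minimal_left_ideal L -> L u -> u <> 0 ->
  exists e p : A,
    [/\ [/\ star e = e, e * e = e, u * e = u & left_multiples u e]
      & [/\ star p = p, p * p = p, p * u = u & right_multiples u p]].
Proof.
move=> minL Lu u0; have [[_ _ LM] _ _] := minL.
set h := star u * u.
have sh : star h = h by rewrite starM starK.
have h0 : h <> 0 by move=> /star_mul_eq0.
have hh0 : h * h <> 0 by rewrite -{1}sh => /star_mul_eq0.
have Lh : L h by exact: LM.
have [b _ bhh] : left_multiples (h * h) h.
  by rewrite (minimal_left_ideal_gen minL)//; exact: LM.
have hhb : h * h * star b = h.
  by have := congr1 star bhh; rewrite starM starM sh.
set e := b * h.
have ehb : e = h * star b by rewrite /e -{1}hhb mulrA bhh.
have se : star e = e by rewrite {1}/e starM sh -ehb.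
have he : h * e = h by rewrite ehb mulrA.
have ee : e * e = e by rewrite {1}/e -mulrA he.
have ue : u * e = u.
  apply/eqP; rewrite eq_sym -subr_eq0; apply/eqP/star_mul_eq0.
  rewrite starB starM se mulrBl -mulrA.
  by rewrite mulrBr (mulrA _ u) he subrr mulr0 subr0.
have eh : e * h = h by rewrite /e -mulrA.
set g := b * h * star b.
have sg : star g = g by rewrite /g starM starK starM sh mulrA.
have gE : g = e * star b by [].
have gh : g * h = e by rewrite /g -(mulrA b) -ehb -mulrA eh.
have eg : e * g = g by rewrite gE mulrA ee.
(* The range projection of [u]: since [g] inverts [h] on [e], [u * g * star u * u = u * e = u]. *)
exists e, (u * g * star u); split; split => //.
- by exists (b * star u) => //; rewrite -mulrA.
- by rewrite starM starK starM sg mulrA.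
- have -> : u * g * star u * (u * g * star u) = u * (g * h * g) * star u.
    by rewrite /h !mulrA.
  by rewrite gh eg.
- by rewrite -mulrA -/h -mulrA gh.
- by exists (g * star u) => //; rewrite mulrA.
Qed.

End Projections.

(** * Invertibility and the diamond relation *)

Theorem proposition2p7 (R : realType) (A : cstarAlgType R)
  (hprime : prime_ring A) (hsoc : socle A <> [set 0]) (a : A) :
  a \is a GRing.unit <->
  (forall u : A, rank_one u ->
     exists x y : A,
       [/\ right_multiples u x /\ x <> 0, left_multiples u y /\ y <> 0,
           diamond_le x a & diamond_le y a]).
Proof.
split=> [ua u [u0 [L minL Lu]]|hdiam].
  have [e [p [[se ee ue [t _ te]] [sp pp pu [r _ rp]]]]] :=
    minimal_left_ideal_projections minL Lu u0.
  exists (p * a), (a * e); split.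
  - split; first by exists (r * a); rewrite // mulrA rp.
    by move=> pa; apply: u0; rewrite -pu -(mulrK ua p) pa !mul0r.
  - split; first by exists (a * t); rewrite // -mulrA te.
    by move=> ae; apply: u0; rewrite -ue -(mulKr ua e) ae !mulr0.
  - split.
    + by move=> _ [z _ <-]; exists (a^-1 * (p * a * z)); rewrite ?mulVKr.
    + by move=> _ [z _ <-]; exists (z * p); rewrite ?mulrA.
    + by rewrite starM sp !mulrA -(mulrA _ p p) pp.
  - split.
    + by move=> _ [z _ <-]; exists (e * z); rewrite ?mulrA.
    + by move=> _ [z _ <-]; exists (z * (a * e) * a^-1); rewrite ?mulrVK.
    + by rewrite starM se !mulrA -(mulrA _ e e) ee.
have [L minL [v Lv v0]] := exists_minimal_left_ideal hsoc.
have [e [_ [[se ee ve [t _ te]] _]]] :=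
  minimal_left_ideal_projections minL Lv v0.
have e0 : e <> 0 by move=> e0; apply: v0; rewrite -ve e0 mulr0.
have minAe : minimal_left_ideal (left_multiples e).
  rewrite (minimal_left_ideal_gen minL)// -te.
  by have [[_ _ LM] _ _] := minL; exact: LM.
have minw w : e * w = w -> w <> 0 -> minimal_left_ideal (left_multiples w).
  by move=> ew w0; rewrite -ew; apply: minimal_left_ideal_mulr; rewrite ?ew.
(* The nonzero [y] in [A w] generates [A w] by minimality, and [A y] lies in [A a]. *)
have memAa w : e * w = w -> left_multiples a w.
  move=> ew; have [->|/eqP w0] := eqVneq w 0.
    by exists 0; rewrite ?mul0r.
  have rw : rank_one w.
    by split=> //; exists (left_multiples w);
      [exact: minw|exact: mem_left_multiples].
  have [_ [y [_ [Awy y0] _ [_ ya _]]]] := hdiam w rw.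
  apply: ya; rewrite (minimal_left_ideal_gen (minw w ew w0))//.
  exact: mem_left_multiples.
have memAsa w : e * w = w -> left_multiples (star a) w.
  move=> ew; have [->|/eqP w0] := eqVneq w 0.
    by exists 0; rewrite ?mul0r.
  (* Condition (2) is used at [star w], which lies in [A e]: the adjoint of [x] is then in both
     [A w] and [A (star a)]. *)
  have rw : rank_one (star w).
    split; first by move=> sw; apply: w0; rewrite -(starK w) sw star0.
    exists (left_multiples e) => //.
    by exists (star w); rewrite // -{2}ew starM se.
  have [x [_ [[[z _ zx] x0] _ [xa _ _] _]]] := hdiam _ rw.
  have [s _ sx] : right_multiples a x by apply: xa; exists 1; rewrite ?mulr1.
  have Awx : left_multiples w (star x).
    by exists (star z); rewrite // -zx starM starK.
  have sx0 : star x <> 0 by move=> sx0; apply: x0; rewrite -(starK x) sx0 star0.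
  have := mem_left_multiples w.
  rewrite -(minimal_left_ideal_gen (minw w ew w0) Awx sx0) => -[q _ <-].
  by exists (q * star s); rewrite // -sx starM mulrA.
have faithful c : (forall z, e * z = z -> z * c = 0) -> c = 0.
  move=> ec; apply: (prime_ring_annihilator hprime e0) => z.
  by apply: ec; rewrite mulrA ee.
have unit_of b1 b2 : star (b1 * b2) = b1 * b2 ->
    (forall w, e * w = w -> left_multiples b1 w) ->
    (forall w, e * w = w -> left_multiples b2 w) ->
    b1 * b2 \is a GRing.unit.
  move=> sb m1 m2.
  (* Given [w = w1 * b2], the element [e * w1] is again in [e A], hence equals some [w2 * b1], and
     [w = e * w = w2 * (b1 * b2)]. *)
  have [|d d0 kd] := @bounded_below _ _ e (b1 * b2).
    move=> w ew; have [w1 _ w1E] := m2 w ew.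
    have [w2 _ w2E] : left_multiples b1 (e * w1).
      by apply: m1; rewrite mulrA ee.
    by exists w2; rewrite sb mulrA w2E -mulrA w1E ew.
  exact: selfadjoint_unit sb d0 kd faithful.
have u1 : a * star a \is a GRing.unit.
  by apply: unit_of => //; rewrite starM starK.
have u2 : star a * a \is a GRing.unit.
  by apply: unit_of => //; rewrite starM starK.
have la : (star a * a)^-1 * star a * a = 1 by rewrite -mulrA mulVr.
have ar : a * (star a * (a * star a)^-1) = 1 by rewrite mulrA divrr.
apply/unitrP; exists ((star a * a)^-1 * star a); split=> //.
have -> : (star a * a)^-1 * star a = star a * (a * star a)^-1.
  by rewrite -[LHS]mulr1 -{1}ar (mulrA _ a) la mul1r.
exact: ar.
Qed.
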